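(* Let $P_1$ and $P_2$ be $\mathcal{S}$-pregroups. If $P_1\equiv_\exists P_2$ with respect to the language $\mathcal{L}^{\mathrm{pre}}_\mathcal{S}$, then $U(P_1)\equiv_\exists U(P_2)$ with respect to the language $\mathcal{L}_\mathcal{S}$.
   Context: A pregroup is a set $P$ with a distinguished element $1$, a map $x\mapsto x^{-1}$, a binary relation $D\subseteq P\times P$ and a ternary relation $M\subseteq P^3$ satisfying, for all elements of $P$: (i) $(x,y,z)\in M\Rightarrow(x,y)\in D$; (ii) $(x,y)\in D\Rightarrow\exists z\,(x,y,z)\in M$; (iii) $(w,x,y),(w,x,z)\in M\Rightarrow y=z$; (iv) $(x,1,x),(1,x,x)\in M$; (v) $(x,x^{-1},1),(x^{-1},x,1)\in M$; (vi) $(x,y,z)\in M\Rightarrow(y^{-1},x^{-1},z^{-1})\in M$; (vii) if $(a,b,r),(b,c,s)\in M$ then for all $x$, $(a,s,x)\in M\iff(r,c,x)\in M$; (viii) if $(a,b,x),(b,c,y),(c,d,z)\in M$ then $\exists r\,(a,y,r)\in M$ or $\exists s\,(y,d,s)\in M$. For $(a,b)\in D$, $ab$ is the unique $c$ with $(a,b,c)\in M$. A word over $P$ is a finite sequence of elements of $P$; it is reduced if no two consecutive entries $c_i,c_{i+1}$ satisfy $(c_i,c_{i+1})\in D$. For words $\mathbf c=(c_1,\dots,c_k)$, $\mathbf a=(a_1,\dots,a_{k-1})$, with $a_0=a_k=1$, if $(a_{i-1}^{-1},c_i)\in D$ and $(a_{i-1}^{-1}c_i,a_i)\in D$ for all $i$,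 the interleaving $\mathbf c*\mathbf a=(d_1,\dots,d_k)$ has $d_i=(a_{i-1}^{-1}c_i)a_i$; $\mathbf c\approx\mathbf d$ means $\mathbf d=\mathbf c*\mathbf a$ for some $\mathbf a$. The universal group $U(P)$ (Stallings) is the set of $\approx$-classes of reduced words, with product given by concatenation followed by reduction (replacing adjacent $c_i,c_{i+1}$ with $(c_i,c_{i+1})\in D$ by $c_ic_{i+1}$) to a reduced word; $P$ embeds in $U(P)$ via one-letter words. Let $\mathcal{S}$ be a set of sets $K$, each $K$ a subset containing $1$ of some fixed pregroup. The language $\mathcal{L}^{\mathrm{pre}}_\mathcal{S}$ has constants $1$ and $d^K_k$ ($k\in K$, $K\in\mathcal{S}$), unary function $^{-1}$, relations $D$ (binary), $M$ (ternary), and a unary predicate $\delta_\mathcal{S}$; an $\mathcal{S}$-pregroup is an $\mathcal{L}^{\mathrm{pre}}_\mathcal{S}$-structure that is a pregroup, satisfies all closed atomic formulas and their negations true in each $K$ (its diagram), and satisfies $d^K_k\in\delta_\mathcal{S}$ and $\forall x(x\notin\delta_\mathcal{S}\rightarrow x\neq d^K_k)$ for all $k\in K$, $K\in\mathcal{S}$. The language $\mathcal{L}_\mathcal{S}$ has the constants $d^K_k$, binary $\cdot$, unary $^{-1}$ and unary predicate $\delta_\mathcal{S}$; $U(P)$ of an $\mathcal{S}$-pregroup $P$ is regarded as an $\mathcal{L}_\mathcal{S}$-structure (an $\mathcal{S}$-group) with constants and $\delta_\mathcal{S}$ interpreted via $P\subseteq U(P)$. $\equiv_\exists$ means satisfying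 the same existential sentences of the indicated language. *)

(* Defs.v *)
From Stdlib Require Import List Arith.
Import ListNotations.

Record pregroup := {
  pc :> Type;
  p1 : pc;
  pinv : pc -> pc;
  pD : pc -> pc -> Prop;
  pM : pc -> pc -> pc -> Prop;
  ax_i : forall x y z, pM x y z -> pD x y;
  ax_ii : forall x y, pD x y -> exists z, pM x y z;
  ax_iii : forall w x y z, pM w x y -> pM w x z -> y = z;
  ax_iv : forall x, pM x p1 x /\ pM p1 x x;
  ax_v : forall x, pM x (pinv x) p1 /\ pM (pinv x) x p1;
  ax_vi : forall x y z, pM x y z -> pM (pinv y) (pinv x) (pinv z);
  ax_vii : forall a b c r s, pM a b r -> pM b c s ->
             forall x, (pM a s x <-> pM r c x);
  ax_viii : forall a b c d x y z, pM a b x -> pM b c y -> pM c d z ->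
             (exists r, pM a y r) \/ (exists s, pM y d s)
}.

Arguments p1 {_}.
Arguments pinv {_} _.
Arguments pD {_} _ _.
Arguments pM {_} _ _ _.

Definition Const (Q : pregroup) (S : (Q -> Prop) -> Prop) : Type :=
  { K : Q -> Prop & (S K * { k : Q | K k })%type }.

Definition const_set {Q : pregroup} {S : (Q -> Prop) -> Prop} (c : Const Q S) : Q -> Prop := projT1 c.
Definition const_val {Q : pregroup} {S : (Q -> Prop) -> Prop} (c : Const Q S) : Q := proj1_sig (snd (projT2 c)).

Inductive pterm (C : Type) : Type :=
| PVar (n : nat) | POne | PCst (c : C) | PInv (t : pterm C).
Arguments PVar {C}. Arguments POne {C}. Arguments PCst {C}. Arguments PInv {C}.

Inductive pform (C : Type) : Type :=
| PEq (t u : pterm C) | PDr (t u : pterm C) | PMr (t u w : pterm C)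
| PDelta (t : pterm C)
| PNeg (f : pform C) | PAnd (f g : pform C) | POr (f g : pform C).
Arguments PEq {C}. Arguments PDr {C}. Arguments PMr {C}. Arguments PDelta {C}.
Arguments PNeg {C}. Arguments PAnd {C}. Arguments POr {C}.

Fixpoint peval (P : pregroup) {C} (cst : C -> P) (v : nat -> P) (t : pterm C) : P :=
  match t with
  | PVar n => v n
  | POne => p1
  | PCst c => cst c
  | PInv t => pinv (peval P cst v t)
  end.

Fixpoint psat (P : pregroup) {C} (cst : C -> P) (dlt : P -> Prop) (v : nat -> P)
  (f : pform C) : Prop :=
  match f with
  | PEq t u => peval P cst v t = peval P cst v u
  | PDr t u => pD (peval P cst v t) (peval P cst v u)
  | PMr t u w => pM (peval P cst v t) (peval P cst v u) (peval P cst v w)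
  | PDelta t => dlt (peval P cst v t)
  | PNeg f => ~ psat P cst dlt v f
  | PAnd f g => psat P cst dlt v f /\ psat P cst dlt v g
  | POr f g => psat P cst dlt v f \/ psat P cst dlt v g
  end.

Fixpoint closed_in {Q : pregroup} {S : (Q -> Prop) -> Prop} (K : Q -> Prop) (t : pterm (Const Q S)) : Prop :=
  match t with
  | PVar _ => False
  | POne => True
  | PCst c => const_set c = K
  | PInv t => closed_in K t
  end.

Definition diag_atom {Q : pregroup} {S : (Q -> Prop) -> Prop} (K : Q -> Prop) (f : pform (Const Q S)) : Prop :=
  match f with
  | PEq t u => closed_in K t /\ closed_in K u
  | PDr t u => closed_in K t /\ closed_in K u
  | PMr t u w => closed_in K t /\ closed_in K u /\ closed_in K w
  | _ => False
  end.

Record Spregroup (Q : pregroup) (S : (Q -> Prop) -> Prop) := {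
  sp :> pregroup;
  sd : Const Q S -> sp;
  sdelta : sp -> Prop;
  (* P satisfies the diagram of each K in S (atomic sentences and negations
     true in K, evaluated in the fixed pregroup Q with d^K_k := k) *)
  s_diag : forall K, S K -> forall f, diag_atom K f ->
     (psat Q const_val (fun _ => False) (fun _ => p1) f <->
      psat sp sd sdelta (fun _ => p1) f);
  s_d_in : forall c, sdelta (sd c);
  s_d_out : forall c x, ~ sdelta x -> x <> sd c
}.
Arguments sp {Q S} _.
Arguments sd {Q S} _ _.
Arguments sdelta {Q S} _ _.

(* existential equivalence in L^pre_S: an existential sentence is the
   existential closure of a quantifier-free formula *)
Definition pre_exists_equiv {Q : pregroup} {S : (Q -> Prop) -> Prop} (P1 P2 : Spregroup Q S) : Prop :=
  forall f : pform (Const Q S),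
    (exists v, psat P1 (sd P1) (sdelta P1) v f) <->
    (exists v, psat P2 (sd P2) (sdelta P2) v f).

Section Words.
Variable P : pregroup.

Definition reduced (w : list P) : Prop :=
  forall i, S i < length w -> ~ pD (nth i w p1) (nth (S i) w p1).

Definition red1 (u v : list P) : Prop :=
  exists a b x y z, u = a ++ x :: y :: b /\ pD x y /\ pM x y z /\ v = a ++ z :: b.

Inductive reduces : list P -> list P -> Prop :=
| rd_refl u : reduces u u
| rd_step u v w : red1 u v -> reduces v w -> reduces u w.

(* a_i with a_0 = a_k = 1, i.e. abnd a k i for 0 <= i <= k *)
Definition abnd (a : list P) (k i : nat) : P :=
  if Nat.eqb i 0 then p1 else if Nat.eqb i k then p1 else nth (i - 1) a p1.

(* d = c * a (0-based index j corresponds to i = j+1) *)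
Definition interleave (c a d : list P) : Prop :=
  let k := length c in
  length a = k - 1 /\ length d = k /\
  forall j, j < k ->
    pD (pinv (abnd a k j)) (nth j c p1) /\
    exists e, pM (pinv (abnd a k j)) (nth j c p1) e /\
              pD e (abnd a k (S j)) /\ pM e (abnd a k (S j)) (nth j d p1).

Definition approx (c d : list P) : Prop := exists a, interleave c a d.

Definition goodword (w : list P) : Prop := w <> nil /\ reduced w.

Definition cls (w : list P) : list P -> Prop := fun v => goodword v /\ approx w v.

Definition isclass (X : list P -> Prop) : Prop :=
  exists w, goodword w /\ forall v, X v <-> cls w v.

Definition seteq (X Y : list P -> Prop) : Prop := forall w, X w <-> Y w.

Definition mulU (X Y : list P -> Prop) : list P -> Prop :=
  fun w => goodword w /\ exists u v r, X u /\ Y v /\ reduces (u ++ v) r /\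
                                     reduced r /\ approx r w.

Definition invU (X : list P -> Prop) : list P -> Prop :=
  fun w => X (rev (map pinv w)).
End Words.

Inductive gterm (C : Type) : Type :=
| GVar (n : nat) | GCst (c : C) | GMul (t u : gterm C) | GInv (t : gterm C).
Arguments GVar {C}. Arguments GCst {C}. Arguments GMul {C}. Arguments GInv {C}.

Inductive gform (C : Type) : Type :=
| GEq (t u : gterm C) | GDelta (t : gterm C)
| GNeg (f : gform C) | GAnd (f g : gform C) | GOr (f g : gform C).
Arguments GEq {C}. Arguments GDelta {C}.
Arguments GNeg {C}. Arguments GAnd {C}. Arguments GOr {C}.

Section UStructure.
Variables (Q : pregroup) (S : (Q -> Prop) -> Prop) (P : Spregroup Q S).

Fixpoint geval (v : nat -> (list P -> Prop)) (t : gterm (Const Q S)) : list P -> Prop :=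
  match t with
  | GVar n => v n
  | GCst c => cls P [sd P c]
  | GMul t u => mulU P (geval v t) (geval v u)
  | GInv t => invU P (geval v t)
  end.

Definition deltaU (X : list P -> Prop) : Prop :=
  exists p, sdelta P p /\ seteq P X (cls P [p]).

Fixpoint gsat (v : nat -> (list P -> Prop)) (f : gform (Const Q S)) : Prop :=
  match f with
  | GEq t u => seteq P (geval v t) (geval v u)
  | GDelta t => deltaU (geval v t)
  | GNeg f => ~ gsat v f
  | GAnd f g => gsat v f /\ gsat v g
  | GOr f g => gsat v f \/ gsat v g
  end.

Definition U_sat_exists (f : gform (Const Q S)) : Prop :=
  exists v : nat -> (list P -> Prop), (forall n, isclass P (v n)) /\ gsat v f.
End UStructure.

Definition U_exists_equiv {Q : pregroup} {S : (Q -> Prop) -> Prop} (P1 P2 : Spregroup Q S) : Prop :=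
  forall f : gform (Const Q S), U_sat_exists Q S P1 f <-> U_sat_exists Q S P2 f.

(* Main.v *)
(** Work with arbitrary, not necessarily reduced, words.  Two moves act on them:
    a reduction [x, y -> xy], and a shift [x, y -> xa, a^-1 y], which keeps the
    length.  Axioms (vii) and (viii) make reduction confluent modulo shifts: the
    two contractions of [p, x, y] differ by a shift, and a redex of a word
    survives a shift up to shifts.  Hence the reduced form of a word is unique
    up to shifts, which on reduced words is [approx]; so every term evaluates
    in [U(P)] to the element represented by the word obtained by substitution,
    and an atomic formula is decided by the reduced form of one word.  A finite
    computation of such reduced forms in [P1] only involves finitely many
    elements, and existential equivalence provides a map from these to [P2]
    under which the computation stays valid. *)

From Stdlib Require Import List Arith Lia Relations Classical ClassicalEpsilon.
Require Import Defs.
Import ListNotations.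

(** * Products and inverses in a pregroup *)

Section Pregroup.
Variable P : pregroup.
Implicit Types x y z : P.
Implicit Types u v w r s : list P.

(** Both sides are the product of [pinv (pinv x)], [pinv x] and [x], bracketed in the two ways that
    axiom (vii) identifies. *)
Lemma pinvK x : pinv (pinv x) = x.
Proof.
  destruct (ax_v P x) as [_ H1]. destruct (ax_v P (pinv x)) as [_ H2].
  destruct (ax_iv P x) as [_ H3]. destruct (ax_iv P (pinv (pinv x))) as [H4 _].
  apply (ax_vii P _ _ _ _ _ H2 H1) in H4.
  exact (ax_iii P _ _ _ _ H4 H3).
Qed.

Lemma pM_cancel_l x y z : pM x y z -> pM (pinv x) z y.
Proof.
  intro H. destruct (ax_v P x) as [_ H1].
  apply (ax_vii P _ _ _ _ _ H1 H). apply ax_iv.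
Qed.

Lemma pM_cancel_r x y z : pM x y z -> pM z (pinv y) x.
Proof.
  intro H. destruct (ax_v P y) as [H1 _].
  apply (ax_vii P _ _ _ _ _ H H1). apply ax_iv.
Qed.

Lemma pM_uncancel_l x y z : pM (pinv x) z y -> pM x y z.
Proof. intro H. rewrite <- (pinvK x). now apply pM_cancel_l. Qed.

Lemma pinv1 : pinv p1 = p1 :> P.
Proof.
  destruct (ax_v P p1) as [H _]. destruct (ax_iv P (pinv p1)) as [_ H'].
  exact (ax_iii P _ _ _ _ H' H).
Qed.

Lemma pM_1r x y : pM x p1 y -> x = y.
Proof. intro H. destruct (ax_iv P x) as [H' _]. exact (ax_iii P _ _ _ _ H' H). Qed.

(** * Reductions and shifts *)

(** An inductive form of [red1]: inversion on two steps from one word enumerates the relative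
    positions of the redexes. *)
Inductive red : list P -> list P -> Prop :=
| red_here x y z w : pM x y z -> red (x :: y :: w) (z :: w)
| red_cons c u v : red u v -> red (c :: u) (c :: v).

(** The premise [pM a y' y] encodes y' = a^-1 y. A shift thus inserts a a^-1 between two neighbours
    and keeps the element that the word represents. *)
Inductive shift : list P -> list P -> Prop :=
| shift_here (a : P) x y x' y' w :
    pM x a x' -> pM a y' y -> shift (x :: y :: w) (x' :: y' :: w)
| shift_cons c u v : shift u v -> shift (c :: u) (c :: v).

Notation shifts := (clos_refl_trans (list P) shift).

Lemma red_app_l c u v : red u v -> red (c ++ u) (c ++ v).
Proof. intro H. induction c; simpl; auto using red_cons. Qed.

Lemma red1_iff u v : red1 P u v <-> red u v.
Proof.
  split.
  - intros (a & b & x & y & z & -> & _ & HM & ->).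
    now apply red_app_l, red_here.
  - induction 1 as [x y z w HM | c u v _ (a & b & x & y & z & -> & HD & HM & ->)].
    + exists [], w, x, y, z. eauto using ax_i.
    + exists (c :: a), b, x, y, z. auto.
Qed.

Lemma red_length u v : red u v -> length u = S (length v).
Proof. induction 1; simpl; congruence. Qed.

Lemma reduces_red u v w : red u v -> reduces P v w -> reduces P u w.
Proof. intro H. apply rd_step, red1_iff, H. Qed.

Lemma reduces_inv u w :
  reduces P u w -> u = w \/ exists v, red u v /\ reduces P v w.
Proof. intros [|u' v w' H H']; auto. apply red1_iff in H. eauto. Qed.

Lemma reduces_trans u v w : reduces P u v -> reduces P v w -> reduces P u w.
Proof. intros H. induction H; eauto using rd_step. Qed.

Lemma reduces_app_l c u v : reduces P u v -> reduces P (c ++ u) (c ++ v).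
Proof.
  induction 1 as [|u v w H _ IH]; [constructor|].
  eapply reduces_red; [apply red_app_l, red1_iff, H | exact IH].
Qed.

Lemma reduces_app_r c u v : reduces P u v -> reduces P (u ++ c) (v ++ c).
Proof.
  induction 1 as [|u v w H _ IH]; [constructor|].
  apply rd_step with (v ++ c); [|exact IH].
  destruct H as (a & b & x & y & z & -> & HD & HM & ->).
  exists a, (b ++ c), x, y, z. now rewrite <- !app_assoc.
Qed.

Lemma reduces_not_nil u v : reduces P u v -> u <> [] -> v <> [].
Proof.
  induction 1 as [|u v w H _ IH]; auto.
  intros _. apply IH. destruct H as (a & b & x & y & z & _ & _ & _ & ->).
  now destruct a.
Qed.

Lemma reduced_split w :
  reduced P w <-> forall a x y b, w = a ++ x :: y :: b -> ~ pD x y.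
Proof.
  split.
  - intros H a x y b ->. specialize (H (length a)).
    rewrite length_app in H. simpl in H.
    rewrite !app_nth2, Nat.sub_diag in H by lia.
    replace (S (length a) - length a) with 1 in H by lia.
    apply H. lia.
  - intros H i Hi. destruct (nth_split w p1 (n := i)) as (l1 & l2 & E & El); [lia|].
    destruct l2 as [|y l2].
    { rewrite E, length_app in Hi. simpl in Hi. lia. }
    replace (nth (S i) w p1) with y; [exact (H _ _ _ _ E)|].
    rewrite E, app_nth2 by lia. now replace (S i - length l1) with 1 by lia.
Qed.

Lemma reduced_iff w : reduced P w <-> ~ exists v, red w v.
Proof.
  rewrite reduced_split. split.
  - intros H [v Hv]. apply red1_iff in Hv.
    destruct Hv as (a & b & x & y & z & E & HD & _). exact (H _ _ _ _ E HD).
  - intros H a x y b -> HD. destruct (ax_ii P _ _ HD) as [z Hz].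
    apply H. exists (a ++ z :: b). now apply red_app_l, red_here.
Qed.

Lemma reduced_reduces r s : reduced P r -> reduces P r s -> r = s.
Proof.
  intros Hr H. destruct (reduces_inv _ _ H) as [|(v & Hv & _)]; auto.
  exfalso. apply reduced_iff in Hr. eauto.
Qed.

Lemma reduced_cons x w : reduced P (x :: w) -> reduced P w.
Proof.
  rewrite !reduced_iff. intros H [v Hv]. eauto using red_cons.
Qed.

Lemma reduced_one x : reduced P [x].
Proof. intros i Hi. simpl in Hi. lia. Qed.

Definition nf u r : Prop := reduces P u r /\ reduced P r.

Lemma nf_exists u : exists r, nf u r.
Proof.
  induction u as [u IH] using (induction_ltof1 _ (@length P)).
  destruct (classic (exists v, red u v)) as [[v Hv]|H].
  - destruct (IH v) as (r & Hr & Hr').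
    { unfold ltof. rewrite (red_length _ _ Hv). lia. }
    exists r. split; eauto using reduces_red.
  - exists u. split; [constructor | now apply reduced_iff].
Qed.

Lemma nf_refl r : reduced P r -> nf r r.
Proof. split; [constructor | trivial]. Qed.

Lemma nf_not_nil u r : nf u r -> u <> [] -> r <> [].
Proof. intros [H _]. eauto using reduces_not_nil. Qed.

Lemma shift_sym u v : shift u v -> shift v u.
Proof.
  induction 1 as [a x y x' y' w H1 H2|]; auto using shift_cons.
  apply shift_here with (pinv a); auto using pM_cancel_l, pM_cancel_r.
Qed.

Lemma shifts_sym u v : shifts u v -> shifts v u.
Proof. induction 1; eauto using rt_refl, rt_step, rt_trans, shift_sym. Qed.

Lemma shifts_length u v : shifts u v -> length u = length v.
Proof.
  induction 1 as [u v H| |]; try congruence.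
  induction H; simpl; congruence.
Qed.

Lemma shifts_cons c u v : shifts u v -> shifts (c :: u) (c :: v).
Proof. induction 1; eauto using rt_refl, rt_step, rt_trans, shift_cons. Qed.

Lemma shifts_app_l c u v : shifts u v -> shifts (c ++ u) (c ++ v).
Proof. intro H. induction c; simpl; auto using shifts_cons. Qed.

Lemma shift_app_r c u v : shift u v -> shift (u ++ c) (v ++ c).
Proof. induction 1; simpl; eauto using shift_here, shift_cons. Qed.

Lemma shifts_app_r c u v : shifts u v -> shifts (u ++ c) (v ++ c).
Proof. induction 1; eauto using rt_refl, rt_step, rt_trans, shift_app_r. Qed.

Lemma shifts_one u x : shifts u [x] -> u = [x].
Proof.
  assert (H : forall v w, shifts v w -> length w = 1 -> v = w).
  { induction 1 as [v w H| |v w t H1 IH1 H2 IH2]; intro E; auto.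
    - destruct H as [|c v w H]; [discriminate|].
      destruct H; discriminate.
    - rewrite IH1, IH2; auto. now rewrite (shifts_length _ _ H2). }
  intro H'. now apply H.
Qed.

(** * Confluence of reduction modulo shifts *)

Lemma red_peak u v w :
  red u v -> red u w -> shifts v w \/ exists t, red v t /\ red w t.
Proof.
  intro H. revert w.
  (* The critical overlap p, x, y: with t = px and s = xy, the words t, y and p, s differ by the
     shift with x^-1. *)
  assert (Hov : forall (p x y t s : P) l, pM p x t -> pM x y s ->
                 shift (t :: y :: l) (p :: s :: l)).
  { intros. apply shift_here with (pinv x); auto using pM_cancel_l, pM_cancel_r. }
  induction H as [x y z l HM|c u v Huv IH]; intros w Hw.
  - inversion Hw as [x0 y0 z0 l0 HM'|c u v Huv]; subst.
    + rewrite (ax_iii P _ _ _ _ HM HM'). left. apply rt_refl.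
    + inversion Huv; subst.
      * left. eauto using rt_step.
      * right. eauto using red_here, red_cons.
  - inversion Hw as [x0 y0 z0 l0 HM'|c' u' v' Huv']; subst.
    + inversion Huv; subst.
      * left. apply rt_step, shift_sym. eauto.
      * right. eauto using red_here, red_cons.
    + destruct (IH _ Huv') as [Hs|(t & H1 & H2)].
      * left. now apply shifts_cons.
      * right. eauto using red_cons.
Qed.

(** If the redex is the shifted pair, (vii) gives the same product. If it shares one letter with
    that pair, (viii) leaves two options: the redex persists after the shift, or the shifted pair
    has a product itself. In the second case that pair is contracted instead, and the result is
    again a shift of [u1]. *)
Lemma shift_red u v u1 :
  shift u v -> red u u1 -> exists v1, red v v1 /\ shifts u1 v1.
Proof.
  intro H. revert u1.
  induction H as [a x y x' y' w H1 H2|c u v Huv IH]; intros u1 Hu.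
  - inversion Hu as [x0 y0 z w0 HM|c u v Hu']; subst.
    + exists (z :: w). split; [|apply rt_refl].
      apply red_here, (ax_vii P _ _ _ _ _ H1 H2), HM.
    + inversion Hu' as [x0 q s w0 HM|c u v0 Hw]; subst.
      * destruct (ax_viii P _ _ _ _ _ _ _
          (pM_cancel_r _ _ _ H1) (pM_cancel_l _ _ _ H2) HM) as [[r Hr]|[r Hr]].
        -- exists (r :: q :: w0). split; [now apply red_here|].
           apply rt_step, shift_here with y; auto.
           now apply (ax_vii P _ _ _ _ _ H1 H2).
        -- exists (x' :: r :: w0). split; [now apply red_cons, red_here|].
           apply rt_step, shift_here with a; auto.
           now apply (ax_vii P _ _ _ _ _ H2 Hr).
      * exists (x' :: y' :: v0). split; [now do 2 apply red_cons|].
        eapply rt_step, shift_here; eauto.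
  - inversion Hu as [p x t w0 HM|c0 u0 u2 Hu']; subst.
    + inversion Huv as [a x0 y x' y' w H1 H2|c0 u0 v0 Hw]; subst.
      * destruct (ax_viii P _ _ _ _ _ _ _ HM H1 H2) as [[r Hr]|[r Hr]].
        -- exists (r :: y' :: w). split; [now apply red_here|].
           apply rt_step, shift_here with a; auto.
           now apply (ax_vii P _ _ _ _ _ HM H1).
        -- exists (c :: r :: w). split; [now apply red_cons, red_here|].
           apply rt_step, shift_here with (pinv x); [now apply pM_cancel_r|].
           now apply pM_cancel_l, (ax_vii P _ _ _ _ _ H1 H2).
      * exists (t :: v0). split; [now apply red_here|].
        now apply rt_step, shift_cons.
    + destruct (IH _ Hu') as (v1 & Hv1 & Hs).
      exists (c :: v1). split; [now apply red_cons | now apply shifts_cons].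
Qed.

Lemma shifts_red u v : shifts u v ->
  forall u1, red u u1 -> exists v1, red v v1 /\ shifts u1 v1.
Proof.
  induction 1 as [u v H|u|u v w _ IH1 _ IH2]; intros u1 Hu.
  - eauto using shift_red.
  - eauto using rt_refl.
  - destruct (IH1 _ Hu) as (v1 & Hv & Hs). destruct (IH2 _ Hv) as (w1 & Hw & Hs').
    eauto using rt_trans.
Qed.

Lemma shifts_reduced u v : shifts u v -> reduced P u -> reduced P v.
Proof.
  rewrite !reduced_iff. intros H Hu [v1 Hv].
  destruct (shifts_red _ _ (shifts_sym _ _ H) _ Hv) as (u1 & Hu1 & _). eauto.
Qed.

(** Shifts keep the length and reductions lower it by one, so induction on the length works although
    shifting does not terminate. The first step from [u] is copied to [v], where it forms a peak
    with the first step of the other reduction; [red_peak] closes the peak. *)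
Theorem reduction_confluent u v r s :
  shifts u v -> nf u r -> nf v s -> shifts r s.
Proof.
  revert v r s.
  induction u as [u IH] using (induction_ltof1 _ (@length P)).
  unfold ltof in IH.
  intros v r s Huv [Hur Hr] [Hvs Hs].
  destruct (reduces_inv _ _ Hur) as [<-|(u1 & Hu1 & Hu1r)].
  { rewrite <- (reduced_reduces v s); eauto using shifts_reduced. }
  destruct (shifts_red _ _ Huv _ Hu1) as (v2 & Hv2 & Hs2).
  destruct (reduces_inv _ _ Hvs) as [<-|(v1 & Hv1 & Hv1s)].
  { exfalso. apply reduced_iff in Hs. eauto. }
  pose proof (red_length _ _ Hu1) as Lu. pose proof (red_length _ _ Hv1) as Lv.
  pose proof (shifts_length _ _ Huv) as Luv.
  destruct (red_peak _ _ _ Hv2 Hv1) as [Hp|(v3 & H2 & H1)].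
  - apply (IH u1 ltac:(lia) v1); [eauto using rt_trans| |]; now split.
  (* A reduced form of the common reduct links [r] and [s] through two uses of the induction
     hypothesis. *)
  - destruct (nf_exists v3) as (r3 & H3 & Hr3).
    apply rt_trans with r3.
    + apply (IH u1 ltac:(lia) v2); [exact Hs2| |]; split; eauto using reduces_red.
    + apply (IH v1 ltac:(lia) v1); [apply rt_refl| |]; split; eauto using reduces_red.
Qed.

(** * Interleavings are shifts *)

(* [interleaved a c d]: [d] is the interleaving of [c] with a sequence whose
   initial entry is [a] instead of [1]. *)
Inductive interleaved : P -> list P -> list P -> Prop :=
| interleaved_last a x y : pM (pinv a) x y -> interleaved a [x] [y]
| interleaved_cons a b x e y c d :
    pM (pinv a) x e -> pM e b y -> interleaved b c d ->
    interleaved a (x :: c) (y :: d).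

(** Here [f] lists the interleaving sequence with both boundary entries. Its initial value is left
    free so that the induction can pass to the tail. *)
Lemma interleaved_of_fun c d (f : nat -> P) :
  c <> [] -> length d = length c -> f (length c) = p1 ->
  (forall j, j < length c -> exists e,
     pM (pinv (f j)) (nth j c p1) e /\ pM e (f (S j)) (nth j d p1)) ->
  interleaved (f 0) c d.
Proof.
  revert d f. induction c as [|x c IH]; intros d f Hc Hl Hk H; [easy|].
  destruct d as [|y d]; [easy|].
  destruct (H 0) as (e & H1 & H2); [simpl; lia|]. simpl in H1, H2.
  destruct c as [|x' c].
  - destruct d; [|easy]. simpl in Hk. rewrite Hk in H2.
    apply pM_1r in H2 as <-. now constructor.
  - apply interleaved_cons with (f 1) e; auto.
    apply (IH d (fun j => f (S j))); auto; [easy|].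
    intros j Hj. apply (H (S j)). simpl in *. lia.
Qed.

Lemma fun_of_interleaved a c d : interleaved a c d ->
  c <> [] /\ length d = length c /\
  exists f : nat -> P, f 0 = a /\ f (length c) = p1 /\
  forall j, j < length c -> exists e,
     pM (pinv (f j)) (nth j c p1) e /\ pM e (f (S j)) (nth j d p1).
Proof.
  induction 1 as [a x y H|a b x e y c d H1 H2 _ (Hc & Hl & f & H0 & Hk & Hf)].
  - split; [easy|]. split; [easy|].
    exists (fun j => match j with 0 => a | _ => p1 end).
    split; [easy|]. split; [easy|].
    intros [|j] Hj; simpl in *; [|lia]. exists y. split; [exact H|apply ax_iv].
  - split; [easy|]. split; [simpl; congruence|].
    exists (fun j => match j with 0 => a | S j => f j end).
    split; [easy|]. split; [easy|].
    intros [|j] Hj; simpl in *.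
    + exists e. now rewrite H0.
    + apply Hf. lia.
Qed.

Lemma approx_interleaved c d : c <> [] -> (approx P c d <-> interleaved p1 c d).
Proof.
  intro Hc. split.
  - intros (a & _ & Hl & H).
    change p1 with (abnd P a (length c) 0).
    apply interleaved_of_fun; auto.
    + unfold abnd. rewrite Nat.eqb_refl. now destruct (length c =? 0).
    + intros j Hj. destruct (H j Hj) as (_ & e & H1 & _ & H2). eauto.
  - intro H. destruct (fun_of_interleaved _ _ _ H) as (_ & Hl & f & H0 & Hk & Hf).
    (* Only the inner entries f 1, ..., f (k-1) are listed; [abnd] supplies 1 at both ends, where
       [f] is 1 as well. *)
    exists (map f (seq 1 (length c - 1))).
    assert (Ha : forall i, i <= length c ->
               abnd P (map f (seq 1 (length c - 1))) (length c) i = f i).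
    { intros i Hi. unfold abnd.
      destruct (Nat.eqb_spec i 0) as [->|Hi0]; [auto|].
      destruct (Nat.eqb_spec i (length c)) as [->|Hik]; [auto|].
      rewrite nth_indep with (d' := f 0) by (rewrite length_map, length_seq; lia).
      rewrite map_nth, seq_nth by lia. f_equal. lia. }
    split; [now rewrite length_map, length_seq|]. split; [exact Hl|].
    intros j Hj. rewrite !Ha by lia.
    destruct (Hf j Hj) as (e & H1 & H2). eauto 7 using ax_i.
Qed.

(** A sweep from left to right: once the pending factor a^-1 is absorbed in the first letter as [e],
    the shift by [b] completes this letter and hands b^-1 to the next one. *)
Lemma interleaved_shifts a c d : interleaved a c d ->
  forall x c' e, c = x :: c' -> pM (pinv a) x e -> shifts (e :: c') d.
Proof.
  induction 1 as [a x y H|a b x e y c d H1 H2 H IH]; intros x' c' e' [= <- <-] He.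
  - rewrite (ax_iii P _ _ _ _ He H). apply rt_refl.
  - rewrite (ax_iii P _ _ _ _ He H1).
    assert (exists x2 c2 e2, c = x2 :: c2 /\ pM (pinv b) x2 e2)
      as (x2 & c2 & e2 & -> & H3) by (destruct H; eauto).
    apply rt_trans with (y :: e2 :: c2); [|eauto using shifts_cons].
    apply rt_step, shift_here with b; auto using pM_uncancel_l.
Qed.

Lemma interleaved_refl c : c <> [] -> interleaved p1 c c.
Proof.
  assert (H1 : forall x, pM (pinv p1) x x) by (intro; rewrite pinv1; apply ax_iv).
  induction c as [|x c IH]; intro Hc; [easy|].
  destruct c as [|y c]; [now constructor|].
  apply interleaved_cons with p1 x; [auto|apply ax_iv|now apply IH].
Qed.

(* If the entry [b1] of the interleaving sequence meets a shift by [b0], the new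
   entry is [b1 b0]; that it exists is axiom (viii), the alternative of which
   would contradict reducedness. *)
Lemma interleaved_shift a c d d' :
  interleaved a c d -> reduced P d -> shift d d' -> interleaved a c d'.
Proof.
  intros H Hr Hs. revert a c H Hr.
  induction Hs as [b0 y1 y2 y1' y2' w Hb1 Hb2|y d d' Hs IH]; intros a c H Hr.
  - inversion H as [|a0 b1 x1 e1 y0 c1 d1 H1 H2 H3]; subst.
    assert (HD : forall t, ~ pM y1 y2 t).
    { intros t Ht. apply ax_i in Ht. revert Ht.
      apply (proj1 (reduced_split _) Hr [] y1 y2 w eq_refl). }
    assert (exists b, pM b1 b0 b) as [b Hb].
    { destruct (ax_viii P _ _ _ _ _ _ _ (pM_cancel_l _ _ _ H2) Hb1 Hb2)
        as [[t Ht]|[t Ht]].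
      - exists t. now apply (ax_vii P _ _ _ _ _ (pM_cancel_l _ _ _ H2) Hb1).
      - exfalso. apply (HD t). now apply (ax_vii P _ _ _ _ _ Hb1 Hb2). }
    apply interleaved_cons with b e1; auto.
    { now apply (ax_vii P _ _ _ _ _ H2 Hb). }
    apply ax_vi in Hb.
    inversion H3 as [b2 x2 z2 H4|a0 b2 x2 e2 z2 c2 d2 H4 H5 H6]; subst.
    + constructor. apply (ax_vii P _ _ _ _ _ Hb H4). now apply pM_cancel_l.
    (* The next letter now meets b^-1 = b0^-1 b1^-1 instead of b1^-1, so [e2] becomes b0^-1 e2. Its
       existence comes from (viii) and reducedness once more. *)
    + assert (exists t, pM (pinv b0) e2 t) as [t Ht].
      { destruct (ax_viii P _ _ _ _ _ _ _ (pM_cancel_r _ _ _ Hb1)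
          (pM_cancel_l _ _ _ Hb2) (pM_cancel_r _ _ _ H5)) as [[t Ht]|[t Ht]].
        - exfalso. apply (HD t). now apply (ax_vii P _ _ _ _ _ Hb1 Hb2).
        - exists t. now apply (ax_vii P _ _ _ _ _
            (pM_cancel_l _ _ _ Hb2) (pM_cancel_r _ _ _ H5)). }
      apply interleaved_cons with b2 t; auto.
      * now apply (ax_vii P _ _ _ _ _ Hb H4).
      * apply (ax_vii P _ _ _ _ _ Ht H5). now apply pM_cancel_l.
  - apply reduced_cons in Hr.
    inversion H as [|a0 b1 x1 e1 y0 c1 d1 H1 H2 H3]; subst; [inversion Hs|].
    eauto using interleaved_cons.
Qed.

Lemma approx_shifts c d : goodword P c -> (approx P c d <-> shifts c d).
Proof.
  intros [Hc Hr]. rewrite (approx_interleaved _ _ Hc). split.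
  - intro H. destruct c as [|x c]; [easy|].
    eapply interleaved_shifts; [exact H|reflexivity|].
    rewrite pinv1. apply ax_iv.
  (* Shifts are added at the far end of the chain, where [interleaved_shift] absorbs them; every
     word of the chain is reduced. *)
  - intro H. apply clos_rt_rtn1 in H.
    induction H as [|d d' Hs H IH]; [now apply interleaved_refl|].
    apply interleaved_shift with d; auto.
    apply clos_rtn1_rt in H. eauto using shifts_reduced.
Qed.

(** * The element represented by a word *)

(** Equality in U(P) for unreduced words; confluence makes the choice of reduced forms immaterial.
    The empty word is not identified with [[p1]], hence the nonemptiness hypotheses in what
    follows. *)
Definition same u v : Prop := exists r s, nf u r /\ nf v s /\ shifts r s.

Lemma same_nf u v r s : same u v -> nf u r -> nf v s -> shifts r s.
Proof.
  intros (r' & s' & Hr' & Hs' & H) Hr Hs.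
  apply rt_trans with r'; [|apply rt_trans with s'; [exact H|]].
  - now apply (reduction_confluent u u); [apply rt_refl| |].
  - now apply (reduction_confluent v v); [apply rt_refl| |].
Qed.

Lemma same_shifts u v : shifts u v -> same u v.
Proof.
  intro H. destruct (nf_exists u) as [r Hr]. destruct (nf_exists v) as [s Hs].
  exists r, s. eauto using reduction_confluent.
Qed.

Lemma same_refl u : same u u.
Proof. apply same_shifts, rt_refl. Qed.

Lemma same_sym u v : same u v -> same v u.
Proof. intros (r & s & Hr & Hs & H). exists s, r. auto using shifts_sym. Qed.

Lemma same_trans u v w : same u v -> same v w -> same u w.
Proof.
  intros (r & s & Hr & Hs & H) H'. destruct (nf_exists w) as [t Ht].
  exists r, t. eauto 6 using rt_trans, same_nf.
Qed.

Lemma same_reduces u v : reduces P u v -> same u v.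
Proof.
  intro H. destruct (nf_exists v) as [r [Hr Hr']].
  exists r, r. repeat split; eauto using reduces_trans, rt_refl.
Qed.

Lemma same_app u u' v v' : same u u' -> same v v' -> same (u ++ v) (u' ++ v').
Proof.
  intros (r & r' & [Hr _] & [Hr' _] & H) (s & s' & [Hs _] & [Hs' _] & H').
  assert (Ha : forall w1 w2 t1 t2, reduces P w1 t1 -> reduces P w2 t2 ->
             same (w1 ++ w2) (t1 ++ t2)).
  { intros. apply same_reduces.
    eauto using reduces_trans, reduces_app_l, reduces_app_r. }
  apply same_trans with (r ++ s); auto.
  apply same_trans with (r' ++ s'); auto using same_sym.
  apply same_shifts.
  eauto using rt_trans, shifts_app_l, shifts_app_r.
Qed.

Lemma same_reduced r s : reduced P r -> reduced P s -> (same r s <-> shifts r s).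
Proof.
  split; [|apply same_shifts]. intro Hs. eauto using same_nf, nf_refl.
Qed.

(** A one-letter word admits no shift, so here the reduced form is unique on the nose. *)
Lemma same_one u r x : nf u r -> (same u [x] <-> r = [x]).
Proof.
  intro Hr. split.
  - intro H. eauto using shifts_one, same_nf, nf_refl, reduced_one.
  - intros ->. now apply same_reduces, Hr.
Qed.

(** * Inverse words and division *)

Definition winv w : list P := rev (map pinv w).

Lemma winvK w : winv (winv w) = w.
Proof.
  unfold winv. rewrite map_rev, rev_involutive, map_map.
  rewrite <- (map_id w) at 2. apply map_ext, pinvK.
Qed.

Lemma winv_cons x u : winv (x :: u) = winv u ++ [pinv x].
Proof. reflexivity. Qed.

Lemma red_winv u v : red u v -> red (winv u) (winv v).
Proof.
  induction 1 as [x y z w H|c u v _ IH]; rewrite !winv_cons.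
  - rewrite <- app_assoc. now apply red_app_l, red_here, ax_vi.
  - apply red1_iff. apply red1_iff in IH.
    destruct IH as (a & b & x & y & z & -> & HD & HM & ->).
    exists a, (b ++ [pinv c]), x, y, z. now rewrite <- !app_assoc.
Qed.

Lemma reduces_winv u v : reduces P u v -> reduces P (winv u) (winv v).
Proof.
  induction 1 as [|u v w H _ IH]; [constructor|].
  eapply reduces_red; [apply red_winv, red1_iff, H | exact IH].
Qed.

Lemma reduced_winv u : reduced P u -> reduced P (winv u).
Proof.
  rewrite !reduced_iff. intros H [v Hv]. apply red_winv in Hv.
  rewrite winvK in Hv. eauto.
Qed.

Lemma goodword_winv u : goodword P u -> goodword P (winv u).
Proof.
  intros [H H']. split; [|now apply reduced_winv].
  intro E. apply H. now rewrite <- (winvK u), E.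
Qed.

Lemma shift_winv u v : shift u v -> shift (winv u) (winv v).
Proof.
  induction 1 as [a x y x' y' w H1 H2|c u v _ IH]; rewrite !winv_cons.
  - rewrite <- !app_assoc. induction (winv w); simpl; [|now apply shift_cons].
    apply shift_here with a.
    + apply pM_cancel_l, ax_vi in H2. now rewrite pinvK in H2.
    + rewrite <- (pinvK a). now apply ax_vi, pM_cancel_r.
  - now apply shift_app_r.
Qed.

Lemma same_winv u v : same u v -> same (winv u) (winv v).
Proof.
  intros (r & s & [Hr Hr'] & [Hs Hs'] & H).
  exists (winv r), (winv s).
  repeat split; auto using reduces_winv, reduced_winv.
  clear - H. induction H; eauto using rt_refl, rt_step, rt_trans, shift_winv.
Qed.

Lemma same_mulV u : u <> [] -> same (u ++ winv u) [p1].
Proof.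
  intro Hu. apply same_reduces.
  induction u as [|x u IH]; [easy|].
  rewrite winv_cons, app_assoc.
  destruct u as [|y u].
  - eapply reduces_red; [apply red_here, ax_v | constructor].
  - apply reduces_trans with ([x; p1] ++ [pinv x]).
    + apply (reduces_app_r [pinv x] (x :: _)), (reduces_app_l [x]), IH. easy.
    + eapply reduces_red; [apply red_here, ax_iv|].
      eapply reduces_red; [apply red_here, ax_v | constructor].
Qed.

Lemma same_mul1 u : u <> [] -> same (u ++ [p1]) u.
Proof.
  intro Hu. destruct (exists_last Hu) as (u' & x & ->).
  rewrite <- app_assoc. apply same_reduces.
  eapply reduces_red; [apply red_app_l, red_here, ax_iv | constructor].
Qed.

Lemma same_1mul u : u <> [] -> same ([p1] ++ u) u.
Proof.
  intro Hu. destruct u as [|x u]; [easy|]. apply same_reduces.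
  eapply reduces_red; [apply red_here, ax_iv | constructor].
Qed.

Lemma winv_not_nil u : u <> [] -> winv u <> [].
Proof. intros Hu E. apply Hu. now rewrite <- (winvK u), E. Qed.

(** Turns an equation into a test on the reduced form of a single word. The converse multiplies by
    v^-1 v on the right. *)
Lemma same_div u v : u <> [] -> v <> [] ->
  (same u v <-> same (u ++ winv v) [p1]).
Proof.
  intros Hu Hv. split; intro H.
  - apply same_trans with (v ++ winv v); [|now apply same_mulV].
    apply same_app; auto using same_refl.
  - apply same_trans with (u ++ [p1]); [now apply same_sym, same_mul1|].
    apply same_trans with ((u ++ winv v) ++ v).
    + rewrite <- app_assoc. apply same_app; [apply same_refl|].
      rewrite <- (winvK v) at 2. now apply same_sym, same_mulV, winv_not_nil.
    + apply same_trans with ([p1] ++ v); [|now apply same_1mul].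
      apply same_app; auto using same_refl.
Qed.

(** The element of U(P) represented by a word that may be unreduced, in contrast to [cls]. *)
Definition val u : list P -> Prop := fun w => goodword P w /\ same u w.

Lemma val_nf u r : u <> [] -> nf u r -> val u r.
Proof.
  intros Hu Hr. repeat split.
  - eauto using nf_not_nil.
  - apply Hr.
  - now apply same_reduces, Hr.
Qed.

Lemma val_eq u v : u <> [] -> (seteq P (val u) (val v) <-> same u v).
Proof.
  intro Hu. split.
  - intro H. destruct (nf_exists u) as [r Hr].
    pose proof (val_nf _ _ Hu Hr) as Hv. destruct (proj1 (H r) Hv) as [_ H'].
    destruct Hv as [_ Hv]. eauto using same_trans, same_sym.
  - intros H w. split; intros [Hw Hs]; split; eauto using same_trans, same_sym.
Qed.

Lemma cls_val u : goodword P u -> seteq P (cls P u) (val u).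
Proof.
  intros Hu w. unfold cls, val. split; intros [Hw H]; split; auto.
  - now apply same_shifts, approx_shifts.
  - apply approx_shifts; auto. destruct Hu, Hw. now apply same_reduced.
Qed.

Lemma goodword_one x : goodword P [x].
Proof. split; [easy | apply reduced_one]. Qed.

(** Representatives may be unreduced, so the image of a representative under any map into another
    pregroup still defines an element there. *)
Lemma isclass_val X : isclass P X <-> exists u, u <> [] /\ seteq P X (val u).
Proof.
  split.
  - intros (u & Hu & H). exists u. split; [apply Hu|].
    intro w. rewrite (H w). now apply cls_val.
  - intros (u & Hu & H). destruct (nf_exists u) as [r Hr].
    destruct (val_nf _ _ Hu Hr) as [Hg Hs].
    exists r. split; auto. intro w. rewrite (H w), (cls_val r Hg w).
    now apply val_eq.
Qed.

Lemma mulU_val X Y u v : u <> [] -> v <> [] ->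
  seteq P X (val u) -> seteq P Y (val v) -> seteq P (mulU P X Y) (val (u ++ v)).
Proof.
  intros Hu Hv HX HY w. split.
  - intros (Hw & u' & v' & r & Hu' & Hv' & Hr & Hr' & Ha).
    apply HX in Hu' as [Hgu Hu']. apply HY in Hv' as [_ Hv'].
    split; auto. apply same_trans with (u' ++ v'); [now apply same_app|].
    apply same_trans with r; [now apply same_reduces|].
    apply same_shifts, approx_shifts; auto. split; auto.
    apply (reduces_not_nil _ _ Hr). destruct Hgu as [Hgu _]. now destruct u'.
  - intros [Hw H].
    destruct (nf_exists u) as [u' Hu']. destruct (nf_exists v) as [v' Hv'].
    destruct (nf_exists (u' ++ v')) as [r Hr].
    split; auto. exists u', v', r.
    split; [now apply HX, val_nf|]. split; [now apply HY, val_nf|].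
    split; [apply Hr|]. split; [apply Hr|].
    apply approx_shifts.
    + split; [|apply Hr]. apply (nf_not_nil _ _ Hr).
      pose proof (nf_not_nil _ _ Hu' Hu). now destruct u'.
    + apply (same_nf (u' ++ v') w); [|exact Hr|apply nf_refl, Hw].
      apply same_trans with (u ++ v); auto.
      apply same_sym, same_app; apply same_reduces; [apply Hu'|apply Hv'].
Qed.

Lemma invU_val X u : seteq P X (val u) -> seteq P (invU P X) (val (winv u)).
Proof.
  intros HX w. unfold invU. rewrite (HX _). fold (winv w). unfold val. split.
  - intros [Hw H]. apply goodword_winv in Hw. apply same_winv in H.
    now rewrite winvK in Hw, H.
  - intros [Hw H]. apply same_winv in H. rewrite winvK in H.
    auto using goodword_winv.
Qed.

End Pregroup.

Arguments nf {P}.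
Arguments same {P}.
Arguments val {P}.
Arguments winv {P}.

(** * Evaluation of terms and atomic formulas in U(P) *)

Section Terms.
Variables (Q : pregroup) (S : (Q -> Prop) -> Prop) (P : Spregroup Q S).

Fixpoint gword (rho : nat -> list P) (t : gterm (Const Q S)) : list P :=
  match t with
  | GVar n => rho n
  | GCst c => [sd P c]
  | GMul t u => gword rho t ++ gword rho u
  | GInv t => winv (gword rho t)
  end.

Lemma gword_not_nil rho t : (forall n, rho n <> []) -> gword rho t <> [].
Proof.
  intro Hrho. induction t as [n|c|t IHt u IHu|t IH]; simpl; auto.
  - easy.
  - now destruct (gword rho t).
  - now apply winv_not_nil.
Qed.

Lemma geval_gword v rho t :
  (forall n, rho n <> []) -> (forall n, seteq P (v n) (val (rho n))) ->
  seteq P (geval Q S P v t) (val (gword rho t)).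
Proof.
  intros Hrho Hv. induction t as [n|c|t IHt u IHu|t IH]; simpl; auto.
  - apply cls_val, goodword_one.
  - apply mulU_val; auto using gword_not_nil.
  - now apply invU_val.
Qed.

Lemma gsat_eq_nf v rho t u r :
  (forall n, rho n <> []) -> (forall n, seteq P (v n) (val (rho n))) ->
  nf (gword rho t ++ winv (gword rho u)) r ->
  (gsat Q S P v (GEq t u) <-> r = [p1]).
Proof.
  intros Hrho Hv Hr. simpl.
  rewrite <- (same_one P _ _ p1 Hr), <- same_div by auto using gword_not_nil.
  rewrite <- val_eq by auto using gword_not_nil.
  pose proof (geval_gword v rho t Hrho Hv) as Ht.
  pose proof (geval_gword v rho u Hrho Hv) as Hu.
  split; intros H w.
  - now rewrite <- (Ht w), <- (Hu w).
  - now rewrite (Ht w), (Hu w).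
Qed.

Lemma gsat_delta_nf v rho t r :
  (forall n, rho n <> []) -> (forall n, seteq P (v n) (val (rho n))) ->
  nf (gword rho t) r ->
  (gsat Q S P v (GDelta t) <-> exists p, r = [p] /\ sdelta P p).
Proof.
  intros Hrho Hv Hr. simpl. unfold deltaU.
  pose proof (geval_gword v rho t Hrho Hv) as Ht.
  assert (Hp : forall p, seteq P (geval Q S P v t) (cls P [p]) <-> r = [p]).
  { intro p. rewrite <- (same_one P _ _ p Hr), <- val_eq by auto using gword_not_nil.
    pose proof (cls_val P [p] (goodword_one P p)) as Hc.
    split; intros H w.
    - now rewrite <- (Ht w), <- (Hc w).
    - now rewrite (Ht w), (Hc w). }
  split; intros (p & H1 & H2); exists p; split; auto; now apply Hp.
Qed.

End Terms.

Arguments gword {Q S P}.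

(** * Finite partial embeddings *)

Section Transfer.
Variables (Q : pregroup) (S : (Q -> Prop) -> Prop) (P1 P2 : Spregroup Q S).

(** Preserving [pM] carries reductions along, and reflecting [pD] keeps reduced words reduced. The
    clauses on 1 and delta go both ways because the truth values of atomic formulas must agree. *)
Record partial_emb (L : list P1) (C : list (Const Q S)) (phi : P1 -> P2) : Prop := {
  pe_M : forall x y z, In x L -> In y L -> In z L ->
           pM x y z -> pM (phi x) (phi y) (phi z);
  pe_D : forall x y, In x L -> In y L -> pD (phi x) (phi y) -> pD x y;
  pe_inv : forall x, In x L -> In (pinv x) L -> phi (pinv x) = pinv (phi x);
  pe_one : forall x, In x L -> (phi x = p1 <-> x = p1);
  pe_cst : forall c, In c C -> In (sd P1 c) L -> phi (sd P1 c) = sd P2 c;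
  pe_delta : forall x, In x L -> (sdelta P2 (phi x) <-> sdelta P1 x)
}.

Lemma partial_emb_incl L L' C C' phi :
  incl L L' -> incl C C' -> partial_emb L' C' phi -> partial_emb L C phi.
Proof. intros HL HC [HM HD Hi H1 Hc Hd]. constructor; auto. Qed.

(** Each formula of [F], or its negation if it fails under [v], enters one conjunction; its
    existential closure holds in [P1] and hence in [P2]. *)
Lemma exists_equiv_qf (v : nat -> P1) (F : list (pform (Const Q S))) :
  pre_exists_equiv P1 P2 ->
  exists v' : nat -> P2, forall f, In f F ->
    (psat P1 (sd P1) (sdelta P1) v f <-> psat P2 (sd P2) (sdelta P2) v' f).
Proof.
  intro Heq.
  assert (Hg : exists g, psat P1 (sd P1) (sdelta P1) v g /\
            forall v', psat P2 (sd P2) (sdelta P2) v' g -> forall f, In f F ->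
    (psat P1 (sd P1) (sdelta P1) v f <-> psat P2 (sd P2) (sdelta P2) v' f)).
  { induction F as [|f F (g & Hg & Hg')].
    - exists (PEq POne POne). split; [reflexivity | easy].
    - destruct (classic (psat P1 (sd P1) (sdelta P1) v f)) as [Hf|Hf].
      + exists (PAnd f g). split; [now split|].
        intros v' [H1 H2] f' [<-|Hf']; [tauto | now apply Hg'].
      + exists (PAnd (PNeg f) g). split; [now split|].
        intros v' [H1 H2] f' [<-|Hf']; [simpl in H1; tauto | now apply Hg']. }
  destruct Hg as (g & Hg & Hg').
  destruct (proj1 (Heq g)) as [v' Hv']; eauto.
Qed.

Lemma partial_emb_exists L C :
  pre_exists_equiv P1 P2 -> exists phi, partial_emb L C phi.
Proof.
  intro Heq. set (I := seq 0 (length L)).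
  (* All atomic facts that [partial_emb] mentions, with the variable [i] naming the entry of [L] at
     position [i]. *)
  set (F := flat_map (fun i =>
    PEq (PVar i) POne :: PDelta (PVar i) :: map (fun c => PEq (PVar i) (PCst c)) C ++
    flat_map (fun j =>
      PDr (PVar i) (PVar j) :: PEq (PVar j) (PInv (PVar i)) ::
      map (fun k => PMr (PVar i) (PVar j) (PVar k)) I) I) I).
  destruct (exists_equiv_qf (fun i => nth i L p1) F Heq) as [v' Hv'].
  (* An element may occur in [L] repeatedly; one position is chosen for it, so that [v'] induces a
     map on elements. Outside [L] the value is arbitrary. *)
  set (idx x := epsilon (inhabits 0) (fun i => i < length L /\ nth i L p1 = x)).
  assert (Hidx : forall x, In x L -> In (idx x) I /\ nth (idx x) L p1 = x).
  { intros x Hx. apply (In_nth _ _ p1) in Hx.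
    destruct (epsilon_spec (inhabits 0) _ Hx) as [H1 H2].
    split; [|exact H2]. apply in_seq. change (0 <= idx x < 0 + length L). unfold idx. lia. }
  assert (HF : forall i f, In i I ->
    (f = PEq (PVar i) POne \/ f = PDelta (PVar i) \/
     (exists c, f = PEq (PVar i) (PCst c) /\ In c C) \/
     exists j, In j I /\
       (f = PDr (PVar i) (PVar j) \/ f = PEq (PVar j) (PInv (PVar i)) \/
        exists k, f = PMr (PVar i) (PVar j) (PVar k) /\ In k I)) -> In f F).
  { intros i f Hi Hf. apply in_flat_map. exists i. split; auto. simpl.
    rewrite in_app_iff, in_map_iff, in_flat_map.
    destruct Hf as [->|[->|[(c & -> & Hc)|(j & Hj & Hf)]]]; auto; do 2 right.
    - left. eauto.
    - right. exists j. split; auto. simpl. rewrite in_map_iff.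
      destruct Hf as [->|[->|(k & -> & Hk)]]; eauto. }
  exists (fun x => v' (idx x)).
  constructor.
  - intros x y z Hx Hy Hz HM.
    destruct (Hidx x Hx) as [Ix Ex]. destruct (Hidx y Hy) as [Iy Ey].
    destruct (Hidx z Hz) as [Iz Ez].
    apply (Hv' (PMr (PVar (idx x)) (PVar (idx y)) (PVar (idx z)))).
    + apply (HF (idx x)); eauto 10.
    + simpl. congruence.
  - intros x y Hx Hy HD.
    destruct (Hidx x Hx) as [Ix Ex]. destruct (Hidx y Hy) as [Iy Ey].
    apply (Hv' (PDr (PVar (idx x)) (PVar (idx y)))) in HD.
    + simpl in HD. congruence.
    + apply (HF (idx x)); eauto 10.
  - intros x Hx Hy.
    destruct (Hidx x Hx) as [Ix Ex]. destruct (Hidx _ Hy) as [Iy Ey].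
    apply (Hv' (PEq (PVar (idx (pinv x))) (PInv (PVar (idx x))))).
    + apply (HF (idx x)); eauto 10.
    + simpl. congruence.
  - intros x Hx. destruct (Hidx x Hx) as [Ix Ex]. rewrite <- Ex at 2.
    symmetry. apply (Hv' (PEq (PVar (idx x)) POne)). apply (HF (idx x)); auto.
  - intros c Hc Hx. destruct (Hidx _ Hx) as [Ix Ex].
    apply (Hv' (PEq (PVar (idx (sd P1 c))) (PCst c))).
    + apply (HF (idx (sd P1 c))); eauto 10.
    + exact Ex.
  - intros x Hx. destruct (Hidx x Hx) as [Ix Ex]. rewrite <- Ex at 2.
    symmetry. apply (Hv' (PDelta (PVar (idx x)))). apply (HF (idx x)); auto.
Qed.

(** * Transport of computations along partial embeddings *)

Lemma reduces_map u r : reduces P1 u r ->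
  exists L, forall phi, partial_emb L [] phi -> reduces P2 (map phi u) (map phi r).
Proof.
  induction 1 as [u|u v w H _ [L IH]].
  - exists []. constructor.
  - destruct H as (a & b & x & y & z & -> & HD & HM & ->).
    (* The list gathers the triples of [pM] used along the reduction. *)
    exists ([x; y; z] ++ L). intros phi Hphi.
    apply reduces_red with (map phi (a ++ z :: b)).
    + rewrite !map_app. simpl. apply red_app_l, red_here.
      apply (pe_M _ _ _ Hphi); simpl; auto.
    + apply IH. revert Hphi. apply partial_emb_incl; auto using incl_appr, incl_refl.
Qed.

Lemma reduced_map phi r : partial_emb r [] phi -> reduced P1 r ->
  reduced P2 (map phi r).
Proof.
  intros Hphi Hr i Hi HD. rewrite length_map in Hi. apply (Hr i Hi).
  assert (Hn : forall j, j < length r -> nth j (map phi r) p1 = phi (nth j r p1)).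
  { intros j Hj. rewrite <- (map_nth phi). apply nth_indep. now rewrite length_map. }
  rewrite !Hn in HD by lia.
  apply (pe_D _ _ _ Hphi) in HD; auto; apply nth_In; lia.
Qed.

Lemma nf_map u r : nf u r ->
  exists L, incl r L /\
    forall phi, partial_emb L [] phi -> nf (map phi u) (map phi r).
Proof.
  intros [H Hr]. destruct (reduces_map _ _ H) as [L HL].
  (* The letters of [r] join the list so that [pD] is reflected on them. *)
  exists (r ++ L). split; [apply incl_appl, incl_refl|].
  intros phi Hphi. split.
  - apply HL. revert Hphi.
    apply partial_emb_incl; auto using incl_appr, incl_refl.
  - apply reduced_map; auto. revert Hphi.
    apply partial_emb_incl; auto using incl_appl, incl_refl.
Qed.

Lemma winv_map L C phi u : partial_emb L C phi -> incl (u ++ map pinv u) L ->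
  winv (map phi u) = map phi (winv u).
Proof.
  intros Hphi Hu. unfold winv. rewrite map_rev, !map_map. f_equal.
  apply map_ext_in. intros x Hx. symmetry.
  apply (pe_inv _ _ _ Hphi); apply Hu, in_app_iff; auto using in_map.
Qed.

Lemma gword_map rho t :
  exists L C, forall phi, partial_emb L C phi ->
    gword (fun n => map phi (rho n)) t = map phi (gword rho t).
Proof.
  induction t as [n|c|t (L1 & C1 & H1) u (L2 & C2 & H2)|t (L & C & H)].
  - exists [], []. reflexivity.
  - exists [sd P1 c], [c]. intros phi Hphi. simpl.
    now rewrite (pe_cst _ _ _ Hphi) by (simpl; auto).
  - exists (L1 ++ L2), (C1 ++ C2). intros phi Hphi. simpl.
    rewrite map_app, H1, H2; auto; revert Hphi; apply partial_emb_incl;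
      auto using incl_appl, incl_appr, incl_refl.
  - exists ((gword rho t ++ map pinv (gword rho t)) ++ L), C. intros phi Hphi. simpl.
    rewrite H.
    + eapply winv_map; [exact Hphi | apply incl_appl, incl_refl].
    + revert Hphi. apply partial_emb_incl; auto using incl_appr, incl_refl.
Qed.

(** Atomic formulas are decided by one reduced form, which [phi] transports. The equivalence in the
    conclusion lets the induction pass through negation. *)
Lemma gsat_map v rho f :
  (forall n, rho n <> []) -> (forall n, seteq P1 (v n) (val (rho n))) ->
  exists L C, forall phi, partial_emb L C phi ->
    (gsat Q S P1 v f <-> gsat Q S P2 (fun n => val (map phi (rho n))) f).
Proof.
  intros Hrho Hv.
  assert (Hrho' : forall (phi : P1 -> P2) n, map phi (rho n) <> []).
  { intros phi n. specialize (Hrho n). now destruct (rho n). }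
  induction f as [t u|t|f (L & C & H)|f (L1 & C1 & H1) g (L2 & C2 & H2)
                 |f (L1 & C1 & H1) g (L2 & C2 & H2)].
  - destruct (gword_map rho t) as (L1 & C1 & H1).
    (* The word of [GInv u] is the inverse of the word of [u], which is the second factor of the
       tested word. *)
    destruct (gword_map rho (GInv u)) as (L2 & C2 & H2).
    destruct (nf_exists P1 (gword rho t ++ winv (gword rho u))) as [r Hr].
    destruct (nf_map _ _ Hr) as (L3 & Hr3 & H3).
    exists (L1 ++ L2 ++ L3), (C1 ++ C2). intros phi Hphi.
    assert (E1 : partial_emb L1 C1 phi) by (revert Hphi; apply partial_emb_incl;
      auto using incl_appl, incl_refl).
    assert (E2 : partial_emb L2 C2 phi) by (revert Hphi; apply partial_emb_incl;
      auto using incl_appl, incl_appr, incl_refl).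
    assert (E3 : partial_emb L3 [] phi) by (revert Hphi; apply partial_emb_incl;
      auto using incl_appr, incl_refl, incl_nil_l).
    specialize (H3 _ E3). rewrite map_app in H3.
    rewrite <- (H1 _ E1) in H3. simpl in H2. rewrite <- (H2 _ E2) in H3.
    rewrite (gsat_eq_nf _ _ _ v rho t u r Hrho Hv Hr).
    rewrite (gsat_eq_nf _ _ _ _ (fun n => map phi (rho n)) t u (map phi r)
      (Hrho' phi) (fun n w => iff_refl _) H3).
    (* Mapping keeps the length, so only a one-letter [r] can be [[p1]] on either side; [pe_one]
       settles that case. *)
    destruct r as [|x [|y r]]; simpl; [easy| |easy].
    pose proof (pe_one _ _ _ E3 x (Hr3 x (or_introl eq_refl))) as H.
    split; intros [= E]; f_equal; tauto.
  - destruct (gword_map rho t) as (L1 & C1 & H1).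
    destruct (nf_exists P1 (gword rho t)) as [r Hr].
    destruct (nf_map _ _ Hr) as (L3 & Hr3 & H3).
    exists (L1 ++ L3), C1. intros phi Hphi.
    assert (E1 : partial_emb L1 C1 phi) by (revert Hphi; apply partial_emb_incl;
      auto using incl_appl, incl_refl).
    assert (E3 : partial_emb L3 [] phi) by (revert Hphi; apply partial_emb_incl;
      auto using incl_appr, incl_refl, incl_nil_l).
    specialize (H3 _ E3). rewrite <- (H1 _ E1) in H3.
    rewrite (gsat_delta_nf _ _ _ v rho t r Hrho Hv Hr).
    rewrite (gsat_delta_nf _ _ _ _ (fun n => map phi (rho n)) t (map phi r)
      (Hrho' phi) (fun n w => iff_refl _) H3).
    split.
    + intros (p & -> & Hp). exists (phi p). split; auto.
      apply (pe_delta _ _ _ E3); auto. apply Hr3. simpl; auto.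
    + intros (q & Hq & Hp). destruct r as [|p [|y r]]; try easy.
      injection Hq as <-. exists p. split; auto.
      apply (pe_delta _ _ _ E3); auto. apply Hr3. simpl; auto.
  - exists L, C. intros phi Hphi. simpl. now rewrite (H _ Hphi).
  - exists (L1 ++ L2), (C1 ++ C2). intros phi Hphi. simpl.
    rewrite (H1 phi), (H2 phi); [reflexivity| |]; revert Hphi;
      apply partial_emb_incl; auto using incl_appl, incl_appr, incl_refl.
  - exists (L1 ++ L2), (C1 ++ C2). intros phi Hphi. simpl.
    rewrite (H1 phi), (H2 phi); [reflexivity| |]; revert Hphi;
      apply partial_emb_incl; auto using incl_appl, incl_appr, incl_refl.
Qed.

Lemma U_sat_exists_transfer f :
  pre_exists_equiv P1 P2 -> U_sat_exists Q S P1 f -> U_sat_exists Q S P2 f.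
Proof.
  intros Heq (v & Hv & Hf).
  (* A representing word is chosen for the value of each variable; its letterwise image under [phi]
     represents the value in U(P2). *)
  set (rho n := epsilon (inhabits []) (fun u => u <> [] /\ seteq P1 (v n) (val u))).
  assert (Hrho : forall n, rho n <> [] /\ seteq P1 (v n) (val (rho n))).
  { intro n. apply (epsilon_spec (inhabits [])), isclass_val, Hv. }
  destruct (gsat_map v rho f) as (L & C & H); try apply Hrho.
  destruct (partial_emb_exists L C Heq) as [phi Hphi].
  exists (fun n => val (map phi (rho n))). split.
  - intro n. apply isclass_val. exists (map phi (rho n)). split; [|easy].
    destruct (Hrho n) as [Hn _]. now destruct (rho n).
  - now apply (H phi Hphi).
Qed.

End Transfer.

Theorem mainTheorem5 (Q : pregroup) (S : (Q -> Prop) -> Prop)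
  (HS : forall K, S K -> K p1) (P1 P2 : Spregroup Q S) :
  pre_exists_equiv P1 P2 -> U_exists_equiv P1 P2.
Proof.
  intros H f. split; apply U_sat_exists_transfer; [exact H|].
  intro g. symmetry. apply H.
Qed.
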